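(* For any finite group $G$, every perfect-code-preserving inner automorphism of $G$ is a power automorphism of $G$.
   Context: All groups and graphs are finite; $e$ denotes the identity. For $S\subseteq G$ with $e\notin S$ and $S^{-1}=S$, the Cayley graph $\mathrm{Cay}(G,S)$ has vertex set $G$, with $x,y$ adjacent iff $yx^{-1}\in S$. A subset $C$ of the vertex set of a graph is a perfect code if every vertex is at distance at most one from exactly one vertex of $C$. An automorphism $\sigma$ of $G$ is perfect-code-preserving if for every Cayley graph $\mathrm{Cay}(G,S)$ and every subset $C\subseteq G$ that is a perfect code in $\mathrm{Cay}(G,S)$, the image $C^\sigma$ is also a perfect code in $\mathrm{Cay}(G,S)$. A power automorphism of $G$ is an automorphism mapping every element $g$ to some power of $g$. *)

(* Defs.v *)
From mathcomp Require Import all_boot all_fingroup.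

Set Implicit Arguments.
Unset Strict Implicit.
Unset Printing Implicit Defensive.

Local Open Scope group_scope.

(* A graph is given by its vertex set V and its adjacency relation e; only the
   restriction of e to V matters. *)

Definition dist_le (T : finType) (V : {set T}) (e : rel T) (n : nat)
    (x y : T) : Prop :=
  exists p : seq T,
    [/\ {subset x :: p <= V}, path e x p, last x p = y & size p <= n].

Definition perfect_code (T : finType) (V : {set T}) (e : rel T)
    (C : {set T}) : Prop :=
  C \subset V /\
  forall x, x \in V -> exists! c, c \in C /\ dist_le V e 1 x c.

Section CayleyGraphs.

Variables (gT : finGroupType) (G : {group gT}).

Definition connection_set (S : {set gT}) : Prop :=
  [/\ S \subset G, 1 \notin S & S^-1 = S].

(* Adjacency of Cay(G, S), whose vertex set is G. *)
Definition cay (S : {set gT}) : rel gT := fun x y => y * x^-1 \in S.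

Definition perfect_code_preserving (sigma : {perm gT}) : Prop :=
  sigma \in Aut G /\
  forall S C : {set gT}, connection_set S ->
    perfect_code G (cay S) C -> perfect_code G (cay S) (sigma @: C).

Definition inner_aut (sigma : {perm gT}) : Prop :=
  sigma \in conj_aut G @* G.

(* As G is finite, natural exponents already give all the powers of g. *)
Definition power_aut (sigma : {perm gT}) : Prop :=
  sigma \in Aut G /\ forall g, g \in G -> exists k : nat, sigma g = g ^+ k.

End CayleyGraphs.

(* Main.v *)
Require Import Defs.
From mathcomp Require Import all_boot all_fingroup.

(**
  For a subgroup H of G, Cay(G, H \ {1}) is a disjoint union of cliques on the
  right cosets of H, so its perfect codes are exactly the right transversals
  of H in G. Take H = <sigma g>. If g were outside H, some right transversal C
  would contain both 1 and g, but sigma(C) contains 1 and sigma g, two distinct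
  elements of H, hence is not a transversal. So g lies in <sigma g>, and as g
  and sigma g have the same order, <sigma g> = <g>.
*)

Set Implicit Arguments.
Unset Strict Implicit.
Unset Printing Implicit Defensive.

Local Open Scope group_scope.

Lemma dist_le1P (T : finType) (V : {set T}) (e : rel T) (x y : T) :
  dist_le V e 1 x y <-> [/\ x \in V, y \in V & x = y \/ e x y].
Proof.
split=> [[[|z [|? ?]] [sV pV <- //=]] | [Vx Vy [<-|exy]]].
- by split; [apply: sV (mem_head _ _) | apply: sV (mem_head _ _) | left].
- split; first exact: sV (mem_head _ _).
    by apply: sV; rewrite !inE eqxx orbT.
  by right; case/andP: pV.
- by exists [::]; split=> // z; rewrite inE => /eqP->.
by exists [:: y]; split=> //= [z|]; rewrite ?exy // !inE => /pred2P[]->.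
Qed.

Section SubgroupConnectionSet.

Variables (gT : finGroupType) (G H : {group gT}).

Lemma subgroup_connection_set : H \subset G -> connection_set G H^#.
Proof.
move=> sHG; split; first exact: subset_trans (subsetDl _ _) sHG.
  by rewrite !inE eqxx.
by apply/setP=> x; rewrite !inE groupV invg_eq1.
Qed.

(** The identity missing from [H^#] is made up for by distance zero, so closed neighbourhoods are
    whole right cosets. *)
Lemma dist_le1_cay_subgroup (x y : gT) :
  dist_le G (cay H^#) 1 x y <-> [/\ x \in G, y \in G & y \in H :* x].
Proof.
apply: iff_trans (dist_le1P _ _ _ _) _.
rewrite /cay !inE mem_rcoset -eq_mulgV1.
split=> [[Gx Gy [<-|/andP[]]] // | [Gx Gy Hyx]]; first by rewrite mulgV group1.
by split=> //; case: eqVneq => [->|_]; [left | right].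
Qed.

Lemma rcoset_choice_perfect_code (sel : {set gT} -> gT) :
    H \subset G -> {in rcosets H G, forall A, sel A \in A} ->
  perfect_code G (cay H^#) (sel @: rcosets H G).
Proof.
move=> sHG selP; split=> [|x Gx].
  apply/subsetP=> _ /imsetP[_ /rcosetsP[y Gy ->] ->].
  have: sel (H :* y) \in H :* y by apply/selP/rcosetsP; exists y.
  by apply/subsetP; rewrite mul_subG ?sub1set.
have Hx : H :* x \in rcosets H G by apply/rcosetsP; exists x.
exists (sel (H :* x)); split.
  split; first exact: imset_f.
  apply/dist_le1_cay_subgroup; split=> //; last exact: selP.
  by apply: subsetP (selP _ Hx); rewrite mul_subG ?sub1set.
(* Uniqueness: a chosen element lying in [H :* x] was chosen from that very coset, as distinct
   cosets are disjoint. *)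
move=> _ [/imsetP[A RA ->] /dist_le1_cay_subgroup[_ _ Hsel]].
have := selP _ RA; case/rcosetsP: RA Hsel => y Gy -> Hsel.
by move/rcoset_eqP=> eqy; congr sel; rewrite -eqy; apply/esym/rcoset_eqP.
Qed.

Lemma perfect_code_through (x : gT) :
    H \subset G -> x \in G -> x \notin H ->
  exists C : {set gT}, [/\ perfect_code G (cay H^#) C, 1 \in C & x \in C].
Proof.
move=> sHG Gx notHx.
(* Since [x] is outside [H], no coset contains both [1] and [x], so the first test never hides the
   second. *)
pose sel (A : {set gT}) := if 1 \in A then 1 else if x \in A then x else repr A.
have selP : {in rcosets H G, forall A, sel A \in A}.
  move=> _ /rcosetsP[y _ ->]; rewrite /sel.
  by do 2!case: ifP => // _; apply: mem_repr_rcoset.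
exists (sel @: rcosets H G); split; first exact: rcoset_choice_perfect_code.
  apply/imsetP; exists (H :* 1); first by apply/rcosetsP; exists 1.
  by rewrite /sel rcoset_refl.
apply/imsetP; exists (H :* x); first by apply/rcosetsP; exists x.
by rewrite /sel rcoset_refl mem_rcoset mul1g groupV (negPf notHx).
Qed.

(** Both [x] and [y] are code elements within distance one of the vertex [x]. *)
Lemma perfect_code_subgroup_inj (C : {set gT}) (x y : gT) :
    perfect_code G (cay H^#) C -> x \in C -> y \in C -> y \in H :* x ->
  x = y.
Proof.
move=> [/subsetP sCG codeC] Cx Cy Hyx.
have [c [_ cuniq]] := codeC x (sCG _ Cx).
have <- : c = y.
  by apply: cuniq; split=> //; apply/dist_le1_cay_subgroup; split; auto.
symmetry; apply: cuniq; split=> //; apply/dist_le1_cay_subgroup.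
by split; rewrite ?rcoset_refl //; auto.
Qed.

End SubgroupConnectionSet.

Lemma perfect_code_preserving_mem_cycle (gT : finGroupType) (G : {group gT})
    (sigma : {perm gT}) (g : gT) :
  perfect_code_preserving G sigma -> g \in G -> g \in <[sigma g]>.
Proof.
move=> [autS pcp] Gg; apply: contraT => notHg.
have sHG : <[sigma g]> \subset G by rewrite cycle_subG (Aut_closed autS).
have [C [codeC C1 Cg]] := perfect_code_through sHG Gg notHg.
have codeSC := pcp _ _ (subgroup_connection_set sHG) codeC.
(* As [sigma 1 = 1], this coset is the subgroup itself. *)
have sg_coset : sigma g \in <[sigma g]> :* sigma 1.
  by rewrite -(autmE autS) morph1 mulg1 cycle_id.
have := perfect_code_subgroup_inj codeSC (imset_f _ C1) (imset_f _ Cg) sg_coset.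
by move/perm_inj=> g1; rewrite -g1 group1 in notHg.
Qed.

Theorem theorem3p5 (gT : finGroupType) (G : {group gT}) (sigma : {perm gT}) :
  inner_aut G sigma -> perfect_code_preserving G sigma -> power_aut G sigma.
Proof.
move=> _ pcp; have autS := pcp.1; split=> // g Gg.
apply/cycleP; suff -> : <[g]> = <[sigma g]> by apply: cycle_id.
(* One inclusion and equal orders suffice; [sigma] preserves orders because it is injective on
   [G]. *)
apply/eqP; rewrite eqEcard cycle_subG.
rewrite (perfect_code_preserving_mem_cycle pcp) //=.
by rewrite -!/(#[_]) -(autmE autS) order_injm ?injm_autm.
Qed.
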